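(* Let $\Gamma=(V,E)$ be a reduced graph which contains no triangles and no cycles of length six, and assume there are no vertices $u,v\in V$ with $N(u)\subsetneq N(v)$. Then $\mathrm{Aut}^{\pi}(\Gamma)=\mathrm{Aut}(\Gamma^2)$.
   Context: Graphs are finite, simple, loopless; $N(v)=\{w:(v,w)\in E\}$; reduced means $N(v)=N(w)\Rightarrow v=w$. $\mathrm{Aut}^{\pi}(\Gamma)$ is the group of bijections $\pi$ of $V$ such that for every $v$ there exists $w$ with $\pi(N(v))=N(w)$. $\Gamma^2$ has vertex set $V$, with $v_1$ adjacent to $v_2$ iff there exists $u$ with $(v_1,u),(u,v_2)\in E$; $\mathrm{Aut}(\Gamma^2)$ is the group of permutations of $V$ preserving this adjacency relation. *)

(* Defs.v *)
From mathcomp Require Import all_boot all_fingroup.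

Set Implicit Arguments.
Unset Strict Implicit.
Unset Printing Implicit Defensive.

Section Graphs.

Variable T : finType.
Implicit Type e : rel T.

Definition simple_graph e := symmetric e /\ irreflexive e.

Definition nbhd e (v : T) : {set T} := [set w | e v w].

Definition reduced e := injective (nbhd e).

(* Cycles are not required to be induced. For k >= 3 a [ucycle] of size k is
   exactly a cycle of length k of the graph; for k <= 2 it is degenerate. *)
Definition no_cycle_of_length k e :=
  forall c : seq T, size c = k -> ~ ucycle e c.

(* v1 = v2 is allowed, so [square e v v] holds as soon as v has a neighbour. *)
Definition square e : rel T := [rel v1 v2 | [exists u, e v1 u && e u v2]].

Definition graph_aut e : {set {perm T}} :=
  [set p : {perm T} | [forall v, forall w, e (p v) (p w) == e v w]].

Definition aut_pi e : {set {perm T}} :=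
  [set p : {perm T} | [forall v, exists w, p @: nbhd e v == nbhd e w]].

Lemma graph_aut_group_set e : group_set (graph_aut e).
Proof.
apply/group_setP; split=> [|p q].
  by rewrite inE; apply/forallP=> v; apply/forallP=> w; rewrite !perm1.
rewrite !inE => /forallP Hp /forallP Hq; apply/forallP=> v; apply/forallP=> w.
by rewrite !permM (eqP (forallP (Hq _) _)) (eqP (forallP (Hp _) _)).
Qed.
Canonical graph_aut_group e := Group (graph_aut_group_set e).

Lemma aut_pi_group_set e : group_set (aut_pi e).
Proof.
apply/group_setP; split=> [|p q].
  rewrite inE; apply/forallP=> v; apply/existsP; exists v; apply/eqP.
  by rewrite -[RHS]imset_id; apply: eq_imset => x; rewrite perm1.
rewrite !inE => /forallP Hp /forallP Hq; apply/forallP=> v.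
have /existsP[w /eqP Hw] := Hp v; have /existsP[z /eqP Hz] := Hq w.
apply/existsP; exists z; apply/eqP; rewrite -Hz -Hw -imset_comp.
by apply: eq_imset => x; rewrite permM.
Qed.
Canonical aut_pi_group e := Group (aut_pi_group_set e).

End Graphs.

(* Main.v *)
(** Adjacency in the square says that two vertices lie in a common
neighbourhood, so [aut_pi] always preserves it. Conversely, without triangles
and hexagons every clique [C] of the square lies in a single neighbourhood:
let [u] meet [C] in as many vertices as possible and suppose [c] in [C] is
missed by [N(u)]. For [b] in [C :&: N(u)], a common neighbour [z] of [b] and
[c] must, by maximality of [u], miss some [b'] in [C :&: N(u)]; a common
neighbour [y] of [b'] and [c] then closes the hexagon [b u b' y c z]. A square
automorphism [p] maps [N(v)] to a clique, hence into some [N(w)], and its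
inverse maps [N(w)] into some [N(v')]; since neighbourhoods are incomparable,
[N(v) = N(v')] and [p] maps [N(v)] onto [N(w)]. *)

Require Import Defs.
From mathcomp Require Import all_boot all_fingroup.

Lemma aut_pi_square {V : finType} {E : rel V} {p : {perm V}} {v w : V} :
  symmetric E -> p \in aut_pi E -> square E v w -> square E (p v) (p w).
Proof.
move=> symE; rewrite inE => /forallP p_aut /existsP[u /andP[Evu Euw]].
have /existsP[x /eqP pNu] := p_aut u.
have Exp y : E u y -> E x (p y).
  move=> Euy; have : p y \in p @: nbhd E u by rewrite imset_f ?inE.
  by rewrite pNu inE.
by apply/existsP; exists x; rewrite symE !Exp // symE.
Qed.

Lemma aut_pi_sub_square_aut {V : finType} {E : rel V} :
  symmetric E -> aut_pi E \subset graph_aut (square E).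
Proof.
move=> symE; apply/subsetP => p p_aut; rewrite inE.
apply/forallP=> v; apply/forallP=> w; apply/eqP.
apply/idP/idP; last exact: aut_pi_square.
(* Reflecting adjacency under [p] is preserving it under the inverse, which is again in the
   group. *)
have pV_aut : (p^-1)%g \in aut_pi E by rewrite -(groupV (aut_pi_group E)) in p_aut.
by move/(aut_pi_square symE pV_aut); rewrite !permK.
Qed.

Section SquareCliques.

Variables (V : finType) (E : rel V).
Hypotheses (symE : symmetric E) (irrE : irreflexive E).
Hypotheses (no_triangle : no_cycle_of_length 3 E)
           (no_hexagon : no_cycle_of_length 6 E).

Lemma edge_neq {x y : V} : E x y -> (x == y) = false.
Proof. by apply: contraTF => /eqP->; rewrite irrE. Qed.

Lemma triangle_free {x y z : V} : E x y -> E y z -> E z x -> False.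
Proof.
move=> Exy Eyz Ezx; apply: (no_triangle [:: x; y; z]) => //.
apply/andP; split; first by rewrite /= Exy Eyz Ezx.
by rewrite /= !inE (edge_neq Exy) (edge_neq Eyz) eq_sym (edge_neq Ezx).
Qed.

(** The case [a = b] is included, so every vertex of [C] has a neighbour in [E]. *)
Definition square_clique (C : {set V}) : Prop :=
  {in C &, forall a b, square E a b}.

Lemma square_clique_nbhd (C : {set V}) :
  square_clique C -> 0 < #|V| -> exists u, C \subset nbhd E u.
Proof.
move=> clC /card_gt0P[u0 _].
have [u _ u_max] := @arg_maxnP V u0 predT (fun u => #|C :&: nbhd E u|) isT.
exists u; apply/subsetP => c Cc; rewrite inE; apply/negPn/negP => nEuc.
(* Otherwise [N(z)] would contain [C :&: N(u)] and also [c], against the maximality of [u]. *)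
have escape z : E z c -> exists2 b, (b \in C) && E u b & ~~ E z b.
  move=> Ezc; have /= := u_max z isT.
  rewrite leqNgt => /negP z_le; case: (boolP (C :&: nbhd E u \subset nbhd E z)).
    move=> sub; case: z_le; apply: proper_card; apply/properP; split.
      by rewrite subsetI subsetIl.
    by exists c; rewrite !inE ?Cc // (negPf nEuc).
  by case/subsetPn => b; rewrite !inE => Cb nEzb; exists b.
have common a b : a \in C -> b \in C -> exists2 x, E x a & E x b.
  move=> Ca Cb; have /existsP[x /andP[Eax Exb]] := clC _ _ Ca Cb.
  by exists x; rewrite // symE.
(* Any neighbour of [c] serves here: it only shows that [C :&: N(u)] is nonempty. *)
have [z0 Ez0c _] := common _ _ Cc Cc.
have [b /andP[Cb Eub] _] := escape _ Ez0c.
have [z Ezb Ezc] := common _ _ Cb Cc.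
have [b' /andP[Cb' Eub'] nEzb'] := escape _ Ezc.
have [y Eyb' Eyc] := common _ _ Cb' Cc.
(* Vertices two steps apart on the hexagon: one of the non-edges [u c] and [z b'] separates them. *)
have neq_bb' : b != b' by apply: contraNneq nEzb' => <-.
have neq_bc : b != c by apply: contraNneq nEuc => <-.
have neq_b'c : b' != c by apply: contraNneq nEuc => <-.
have neq_uy : u != y by apply: contraNneq nEuc => ->.
have neq_uz : u != z by apply: contraNneq nEuc => ->.
have neq_yz : y != z by apply: contraNneq nEzb' => <-.
(* Opposite vertices of the hexagon: a coincidence would create a triangle. *)
have neq_by : b != y.
  by apply/eqP => eby; subst y; apply: (triangle_free Ezb Eyc); rewrite symE.
have neq_uc : u != c.
  by apply/eqP => euc; subst u; apply: (triangle_free Ezc Eub); rewrite symE.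
have neq_b'z : b' != z.
  by apply/eqP => ebz; subst z; apply: (triangle_free Eub' Ezb); rewrite symE.
apply: (no_hexagon [:: b; u; b'; y; c; z]) => //; apply/andP; split.
  by rewrite /= symE Eub Eub' symE Eyb' Eyc symE Ezc Ezb.
rewrite /= !inE !negb_or neq_bb' neq_bc neq_b'c neq_uy neq_uz neq_yz.
rewrite neq_by neq_uc neq_b'z (eq_sym b u) (eq_sym b z) (eq_sym b' y) (eq_sym c z).
by rewrite !edge_neq.
Qed.

Lemma square_aut_imset_nbhd (p : {perm V}) (v : V) :
  p \in graph_aut (square E) -> exists w, p @: nbhd E v \subset nbhd E w.
Proof.
rewrite inE => /forallP p_aut; apply: square_clique_nbhd; last first.
  by apply/card_gt0P; exists v.
move=> _ _ /imsetP[a Ea ->] /imsetP[b Eb ->].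
rewrite (eqP (forallP (p_aut a) b)); apply/existsP; exists v.
by move: Ea Eb; rewrite !inE symE => -> ->.
Qed.

End SquareCliques.

Theorem theorem3p6 (V : finType) (E : rel V)
  (simpleE : simple_graph E)
  (reducedE : reduced E)
  (no_triangle : no_cycle_of_length 3 E)
  (no_hexagon : no_cycle_of_length 6 E)
  (no_proper_nbhd : ~ exists u v : V, nbhd E u \proper nbhd E v) :
  aut_pi_group E = graph_aut_group (square E).
Proof.
have [symE irrE] := simpleE.
apply/val_inj/eqP; rewrite /= eqEsubset aut_pi_sub_square_aut //=.
apply/subsetP => p p_aut; rewrite inE; apply/forallP => v; apply/existsP.
have into := square_aut_imset_nbhd V E symE irrE no_triangle no_hexagon.
have [w pNv] := into p v p_aut; exists w.
have pV_aut : (p^-1)%g \in graph_aut (square E).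
  by rewrite -(groupV (graph_aut_group (square E))) in p_aut.
have [v' pNw] := into _ w pV_aut.
have Nvv' : nbhd E v \subset nbhd E v'.
  apply: subset_trans pNw; apply/subsetP => x Nx; apply/imsetP; exists (p x).
    by apply: (subsetP pNv); apply: imset_f.
  by rewrite permK.
rewrite eqEsubset pNv; apply/subsetP => x Nx.
apply/imsetP; exists ((p^-1)%g x); last by rewrite permKV.
have : (p^-1)%g x \in nbhd E v' by apply: (subsetP pNw); apply: imset_f.
(* [N(v')] cannot strictly contain [N(v)], so the inclusion [Nvv'] reverses. *)
apply: (subsetP _); apply/negPn/negP => nNv'v.
by apply: no_proper_nbhd; exists v, v'; rewrite properE Nvv'.
Qed.
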